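(* Let $d\geq 3$ be an integer. There exists a constant $c_d>0$ (depending only on $d$) such that for any prime power $q$ and any integer $\ell\geq c_d\log q$, there exists a blocking family of degree $\underbrace{(d,d,\dots,d)}_{\ell\text{ times}}$ over $\mathbb{F}_q$.
   Context: A set $B\subseteq\mathbb{P}^2(\mathbb{F}_q)$ is a blocking set if it intersects every $\mathbb{F}_q$-line of $\mathbb{P}^2$. Plane curves $C_1,\dots,C_\ell$ defined over $\mathbb{F}_q$ form a blocking family of degree $(d_1,\dots,d_\ell)$ over $\mathbb{F}_q$ if each $C_i$ is geometrically irreducible (irreducible over $\overline{\mathbb{F}_q}$), $\deg(C_i)=d_i>1$ for each $i$, and $\bigcup_{i=1}^{\ell}C_i(\mathbb{F}_q)$ is a blocking set in $\mathbb{P}^2(\mathbb{F}_q)$. The curves $C_i$ are not required to be pairwise distinct. $\log$ is the natural logarithm. *)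

(* Defs.v *)
From mathcomp Require Import all_boot all_order all_algebra all_field.
From mathcomp Require Import mpoly.
From mathcomp Require Import reals exp.

Set Implicit Arguments.
Unset Strict Implicit.
Unset Printing Implicit Defensive.

Import Order.TTheory GRing.Theory Num.Theory.
Local Open Scope ring_scope.

(* P^2(F): points and lines are the subspaces of F^3 of dimension 1 and 2. *)
Definition proj_point (F : fieldType) : Type :=
  {P : {vspace 'rV[F]_3} | (\dim P == 1)%N}.

Definition proj_line (F : fieldType) : Type :=
  {L : {vspace 'rV[F]_3} | (\dim L == 2)%N}.

Definition incident (F : fieldType) (P : proj_point F) (L : proj_line F) : bool :=
  (val P <= val L)%VS.

Definition blocking_set (F : fieldType) (B : proj_point F -> Prop) : Prop :=
  forall L : proj_line F, exists2 P : proj_point F, B P & incident P L.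

(* A plane curve over F is given by a defining form, not assumed reduced;
   the form is unique up to a nonzero scalar. *)
Definition plane_curve (F : fieldType) (d : nat) (f : {mpoly F[3]}) : Prop :=
  f != 0 /\ f \is d.-homog.

Definition rational_point (F : fieldType) (f : {mpoly F[3]})
    (P : proj_point F) : Prop :=
  forall v : 'rV[F]_3, v \in val P -> f.@[v 0] = 0.

Definition irreducible_elt (R : idomainType) (x : R) : Prop :=
  [/\ x != 0, x \isn't a GRing.unit &
      forall a b : R, x = a * b -> a \is a GRing.unit \/ b \is a GRing.unit].

Definition alg_closure (F : countFieldType) : countClosedFieldType :=
  projT1 (countable_algebraic_closure F).

Definition to_alg_closure (F : countFieldType) : {rmorphism F -> alg_closure F} :=
  sval (projT2 (countable_algebraic_closure F)).

Definition geometrically_irreducible (F : countFieldType) (f : {mpoly F[3]}) : Prop :=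
  irreducible_elt (map_mpoly (to_alg_closure F) f).

Definition blocking_family (F : finFieldType) (l : nat) (d : 'I_l -> nat)
    (C : 'I_l -> {mpoly F[3]}) : Prop :=
  [/\ forall i, plane_curve (d i) (C i) /\ (1 < d i)%N,
      forall i, geometrically_irreducible (C i) &
      blocking_set (fun P => exists i, rational_point (C i) P)].

(* Main.v *)
(* The curves used are the graphs f_b = Y Z^(d-1) - X^d - b Z^d for b in F_q.
   All of them pass through (0 : 1 : 0), so only the q^2 lines y = m x + c
   matter.  Such a line meets the graph of f_b in an affine point as soon as b
   is a value of m x + c - x^d, and this polynomial, having fibres of size at
   most d, takes at least q / d values: every line is hit by a proportion at
   least 1/d of the family.  Choosing l curves greedily therefore leaves at most
   q^2 (1 - 1/d)^l <= q^2 exp (- l / d) lines unhit, which is less than 1 once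
   l >= (2 d + 1) log q.  Each f_b is irreducible over any field since it is
   linear in Y with coprime coefficients. *)

From HB Require Import structures.
Require Import Defs.
From mathcomp Require Import all_boot all_order all_algebra all_field.
From mathcomp Require Import mpoly.
From mathcomp Require Import reals sequences exp.
From mathcomp Require Import ring lra.

Set Implicit Arguments.
Unset Strict Implicit.
Unset Printing Implicit Defensive.

Import Order.TTheory GRing.Theory Num.Theory.
Local Open Scope ring_scope.

(** * Greedy covering *)

(** Averaging: counting the hit pairs in [U] by [i] gives at least [#|U| * #|B| / d], so some [b]
    reaches the mean. *)
Lemma greedy_step (I B : finType) (hit : I -> B -> bool) (d : nat) (U : {set I}) :
    (0 < #|B|)%N -> (forall i, #|B| <= d * #|[set b | hit i b]|)%N ->
  exists b, (#|U| <= d * #|[set i in U | hit i b]|)%N.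
Proof.
move=> B_gt0 hitP; apply/existsP; apply: contraLR B_gt0.
rewrite negb_exists -leqNgt => /forallP noB.
have eqS : (\sum_b #|[set i in U | hit i b]| = \sum_(i in U) #|[set b | hit i b]|)%N.
  under eq_bigr do rewrite -sum1_card; under [RHS]eq_bigr do rewrite -sum1_card.
  rewrite (exchange_big_dep (mem U)) => [|b i _] /=; last by rewrite inE => /andP[].
  by apply: eq_bigr => i iU; apply: eq_bigl => b; rewrite !inE iU.
have lo : (#|U| * #|B| <= d * \sum_b #|[set i in U | hit i b]|)%N.
  by rewrite eqS big_distrr -sum_nat_const leq_sum.
(* If every [b] fails, each failure is strict by at least one, which adds up to [#|B|]; against [lo]
   this forces [B] to be empty. *)
have hi : (#|B| + d * \sum_b #|[set i in U | hit i b]| <= #|B| * #|U|)%N.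
  rewrite big_distrr -[X in (X + _)%N]sum1_card -big_split -sum_nat_const.
  rewrite leq_sum //= => b _; by rewrite add1n ltnNge noB.
by rewrite -(leq_add2r (d * \sum_b #|[set i in U | hit i b]|)) add0n (leq_trans hi) // mulnC.
Qed.

(** Each greedy choice leaves at most a fraction 1 - 1/d of the unhit elements; powers of [d] are
    cleared to stay in the naturals. *)
Lemma greedy_cover (I B : finType) (hit : I -> B -> bool) (d n : nat) :
    (0 < #|B|)%N -> (forall i, #|B| <= d * #|[set b | hit i b]|)%N ->
  exists s : n.-tuple B,
    (#|[set i | ~~ has (hit i) s]| * d ^ n <= #|I| * d.-1 ^ n)%N.
Proof.
move=> B_gt0 hitP; elim: n => [|n [s IHs]].
  by exists [tuple]; rewrite !muln1 max_card.
pose U := [set i | ~~ has (hit i) s].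
have [b bP] := greedy_step U B_gt0 hitP.
exists [tuple of b :: s].
have -> : [set i | ~~ has (hit i) (b :: s)] = U :\: [set i in U | hit i b].
  by apply/setP => i; rewrite !inE /= negb_or negb_and andb_orl andNb /= andbC.
rewrite !expnS [leqRHS]mulnCA mulnA.
rewrite (leq_trans _ (leq_mul (leqnn _) IHs)) // mulnA leq_mul2r; apply/orP; right.
rewrite cardsD (setIidPr _); last by apply/subsetP => i; rewrite inE => /andP[].
by rewrite mulnC mulnBr -subn1 mulnBl mul1n leq_sub2l.
Qed.

(** * Value sets of polynomials *)

Lemma card_horner_image (F : finFieldType) (p : {poly F}) (d : nat) :
    (1 < size p <= d.+1)%N ->
  (#|F| <= d * #|[set b | [exists x, p.[x] == b]]|)%N.
Proof.
case/andP=> p_gt1 p_le.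
have fibre b : (#|[set x | p.[x] == b]| <= d)%N.
  have sb : size (p - b%:P) = size p.
    by rewrite size_polyDl // size_polyN (leq_ltn_trans (size_polyC_leq1 _)).
  have pb0 : p - b%:P != 0 by rewrite -size_poly_gt0 sb ltnW.
  rewrite cardE -ltnS (leq_trans _ p_le) // -sb max_poly_roots ?enum_uniq //.
  apply/allP => x; rewrite mem_enum inE => /eqP pxb.
  by rewrite rootE !hornerE pxb subrr.
pose im := [set b | [exists x, p.[x] == b]].
rewrite -[#|F|]sum1_card (partition_big (horner p) (mem im)) => [|x _] /=; last first.
  by rewrite inE; apply/existsP; exists x.
rewrite mulnC -sum_nat_const leq_sum // => b _.
by rewrite sum1_card (leq_trans _ (fibre b)) // cardsE.
Qed.

(** * The curves and their irreducibility *)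

(** Homogenisation of y = x^d + b, over any commutative ring so that it can be carried to the
    algebraic closure. *)
Definition graph_form (F : comNzRingType) (d : nat) (b : F) : {mpoly F[3]} :=
  'X_1 * 'X_2%R ^+ d.-1 - 'X_0 ^+ d - b *: 'X_2%R ^+ d.

Lemma graph_form_homog (F : comNzRingType) (d : nat) (b : F) :
  (0 < d)%N -> graph_form d b \is d.-homog.
Proof.
have XP (i : 'I_3) k : ('X_i : {mpoly F[3]}) ^+ k \is k.-homog.
  have := @dhomogMn 3 F mdeg 1 'X_i k; rewrite mul1n; apply.
  by rewrite dhomogX; apply/eqP; exact: mdeg1.
move=> d_gt0; rewrite !rpredB ?rpredZ ?XP //.
have := @dhomogM 3 F mdeg 1 'X_1 d.-1 ('X_2%R ^+ d.-1); rewrite add1n prednK //.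
by apply; rewrite ?XP // -['X_1]expr1.
Qed.

Lemma map_graph_form (F K : comNzRingType) (f : {rmorphism F -> K}) (d : nat) (b : F) :
  map_mpoly f (graph_form d b) = graph_form d (f b).
Proof. by rewrite !rmorphB /= map_mpolyZ rmorphM !rmorphXn /= !map_mpolyX. Qed.

Lemma meval_graph_form (F : comNzRingType) (d : nat) (b : F) (v : 'I_3 -> F) :
  (graph_form d b).@[v] = v 1 * v 2%R ^+ d.-1 - v 0 ^+ d - b * v 2%R ^+ d.
Proof. by rewrite !rmorphB /= mevalZ rmorphM !rmorphXn /= !mevalXU. Qed.

Lemma mlead0_unit (K : fieldType) (n : nat) (a : {mpoly K[n]}) :
  a != 0 -> mlead a = 0%MM -> a \is a GRing.unit.
Proof.
move=> a_neq0 la; have aC : a = (a@_0)%:MP.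
  by apply: msize1_polyC; rewrite -mlead_deg // la mdeg0.
have a0 : a@_0 != 0 by apply: contraNneq a_neq0 => a0; rewrite aC a0 mpolyC0.
move: (a@_0) a0 aC => c c0 ->; apply/unitrP; exists (c^-1)%:MP.
by rewrite -!mpolyCM mulVf ?mulfV.
Qed.

Lemma mpolyX_neq0 (R : nzRingType) (n : nat) (m : 'X_{1..n}) :
  'X_[m] != 0 :> {mpoly R[n]}.
Proof. by rewrite -msize_poly_eq0 msizeX. Qed.

(** Leading monomials multiply over a field, so that of [a] divides a power of ['X_i]. *)
Lemma mlead_dvd_XU (K : fieldType) (n : nat) (i j : 'I_n) (k : nat) (a h : {mpoly K[n]}) :
  a * h = 'X_i ^+ k -> j != i -> mlead a j = 0%N.
Proof.
move=> ahX ji.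
have : a * h != 0 by rewrite ahX expf_neq0 // mpolyX_neq0.
rewrite mulf_eq0 negb_or => /andP[a0 h0].
have /(congr1 (fun m : 'X_{1..n} => m j)) := mleadM a0 h0.
rewrite ahX mpolyXn mleadXm mnmDE mulmnE mnm1E eq_sym (negPf ji) mul0n.
by move/esym/eqP; rewrite addn_eq0 => /andP[/eqP].
Qed.

Section AdjoinVariable.
Variables (K : fieldType) (n : nat) (i : 'I_n).

(* Replaces 'X_i by a fresh variable, the other variables becoming constants;
   evaluating at 'X_i undoes it, so a constant image forces p itself to be that
   constant. *)
Definition adjoin_var : {mpoly K[n]} -> {poly {mpoly K[n]}} :=
  mmap (polyC \o @mpolyC n K) (fun j => if j == i then 'X else ('X_j)%:P).

HB.instance Definition _ := GRing.RMorphism.on adjoin_var.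

Lemma adjoin_varK (p : {mpoly K[n]}) : (adjoin_var p).['X_i] = p.
Proof.
rewrite [p in RHS]mpolyE /adjoin_var /mmap horner_sum.
apply: eq_bigr => m _ /=.
rewrite hornerM hornerC mul_mpolyC; congr (_ *: _).
rewrite [RHS]mpolyXE_id /mmap1 horner_prod; apply: eq_bigr => j _ /=.
rewrite horner_exp; case: eqP => [->|_]; first by rewrite hornerX.
by rewrite hornerC.
Qed.

Lemma adjoin_varX j : adjoin_var 'X_j = if j == i then 'X else ('X_j)%:P.
Proof. by rewrite /adjoin_var mmapX mmap1U. Qed.

Lemma adjoin_varZ c p : adjoin_var (c *: p) = (c%:MP)%:P * adjoin_var p.
Proof. exact: mmapZ. Qed.

End AdjoinVariable.

(** The form has degree 1 in ['X_1], so one factor is free of ['X_1] and divides both coefficients;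
    such a factor is shown to be a unit. *)
Lemma irreducible_graph_form (K : fieldType) (d : nat) (b : K) :
  (0 < d)%N -> irreducible_elt (graph_form d b).
Proof.
move=> d_gt0.
pose X : {mpoly K[3]} := 'X_0; pose Z : {mpoly K[3]} := 'X_2%R.
pose phi : {rmorphism {mpoly K[3]} -> {poly {mpoly K[3]}}} := @adjoin_var K 3 1.
have phif : phi (graph_form d b) = (Z ^+ d.-1) *: 'X - (X ^+ d + b *: Z ^+ d)%:P.
  rewrite /graph_form /phi !rmorphB /= adjoin_varZ rmorphM !rmorphXn /= !adjoin_varX /=.
  by rewrite -!rmorphXn -rmorphM /= mul_mpolyC rmorphD opprD addrA -mul_polyC mulrC.
have Z0 : Z ^+ d.-1 != 0 by rewrite expf_neq0 // mpolyX_neq0.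
have sizef : size (phi (graph_form d b)) = 2.
  rewrite phif size_polyDl ?size_scale ?size_polyX // size_polyN.
  by rewrite (leq_ltn_trans (size_polyC_leq1 _)).
have f0 : graph_form d b != 0.
  by apply: contraPneq sizef => ->; rewrite rmorph0 size_poly0.
have unit_of_const (a h : {mpoly K[3]}) :
    graph_form d b = a * h -> (size (phi a) <= 1)%N -> a \is a GRing.unit.
  move=> fah /size1_polyC phia.
  have phiaE : phi a = a%:P.
    have aE : (phi a).['X_1] = a := adjoin_varK 1 a.
    by move: aE; rewrite phia hornerC => ->.
  have fE : (Z ^+ d.-1) *: 'X - (X ^+ d + b *: Z ^+ d)%:P = a *: phi h.
    by rewrite -phif fah rmorphM /= phiaE mul_polyC.
  have aZ : a * (phi h)`_1 = Z ^+ d.-1.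
    by move/(congr1 (coefp 1)): fE; rewrite /= coefB !coefZ coefX coefC mulr1 subr0.
  have aXZ : a * (phi h)`_0 = - (X ^+ d + b *: Z ^+ d).
    by move/(congr1 (coefp 0)): fE; rewrite /= coefB !coefZ coefX coefC mulr0 sub0r.
  (* Subtracting b Z times the relation [aZ] cancels the term b Z^d and leaves the pure power
     X^d. *)
  have aX : a * (- (phi h)`_0 - b *: (phi h)`_1 * Z) = X ^+ d.
    rewrite mulrBr mulrN aXZ opprK -scalerAl -scalerAr mulrA aZ -exprSr prednK //.
    by rewrite addrK.
  have a0 : a != 0 by apply: contraNneq f0 => a0; rewrite fah a0 mul0r.
  (* a divides the monomials Z^(d-1) and X^d, so its leading monomial is 1 *)
  apply: mlead0_unit => //; apply/mnmP => j; rewrite mnm0E.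
  have [->|j0] := eqVneq j 0; first exact: (mlead_dvd_XU aZ).
  exact: mlead_dvd_XU aX j0.
clearbody phi; split=> //; last first.
  move=> a h fah.
  have sah : size (phi a * phi h) = 2 by rewrite -rmorphM -fah sizef.
  have /andP[a0 h0] : (phi a != 0) && (phi h != 0).
    by rewrite -negb_or -mulf_eq0 -size_poly_eq0 sah.
  move: sah; rewrite (size_mul a0 h0); move: a0 h0; rewrite -!size_poly_gt0.
  (* The two sizes are positive and add up to 3, so one of them is 1. *)
  case sa: (size (phi a)) => [|[|m]] // _; first by left; apply: unit_of_const fah _; rewrite sa.
  case sh: (size (phi h)) => [|[|k]] // _; last by rewrite !addSn !addnS.
  by right; rewrite mulrC in fah; apply: unit_of_const fah _; rewrite sh.
apply/negP => /(rmorph_unit phi); rewrite poly_unitE.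
by rewrite sizef.
Qed.

(** * Numerical estimate *)

Lemma expR_ratio_bound (R : realType) (d q l : nat) :
    (0 < d)%N -> (1 < q)%N -> (2 * d).+1%:R * ln q%:R <= l%:R :> R ->
  (q * q * d.-1 ^ l < d ^ l)%N.
Proof.
move=> d_gt0 q_gt1 le_l; rewrite -(ltr_nat R) !natrM !natrX.
have d0 : 0 < d%:R :> R by rewrite ltr0n.
have q0 : 0 < q%:R :> R by rewrite ltr0n ltnW.
have lnq : 0 < ln q%:R :> R by rewrite ln_gt0 // ltr1n.
(* This is 1 - 1/d <= exp(-1/d), multiplied by [d]. *)
have dE : d.-1%:R <= d%:R * expR (- d%:R^-1) :> R.
  apply: le_trans (ler_wpM2l (ltW d0) (expR_ge1Dx _)).
  by rewrite mulrDr mulr1 mulrN mulfV ?gt_eqF // -subn1 natrB.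
have qE : q%:R = expR (ln q%:R) :> R by rewrite lnK ?posrE.
rewrite qE (le_lt_trans (ler_wpM2l _ (lerXn2r _ _ _ dE))) ?nnegrE ?mulr_ge0 ?expR_ge0 ?ler0n //.
rewrite exprMn -expRM_natl mulrCA -!expRD gtr_pMr ?exprn_gt0 // expR_lt1.
rewrite mulrN subr_lt0 ltr_pdivlMr //.
(* What remains is 2 d log q < (2 d + 1) log q: the extra log q > 0 makes the bound strict. *)
apply: lt_le_trans le_l.
by rewrite -addn1 natrD natrM; nra.
Qed.

(** * Lines and points of the plane *)

Definition row3 (F : nzRingType) (x y z : F) : 'rV[F]_3 := \row_(j < 3) [:: x; y; z]`_j.

(** The plane [L] is a complement of the span of (0, 1, 0), so any vector can be moved into [L] by
    changing its middle coordinate only. *)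
Lemma line_affine_param (F : fieldType) (L : {vspace 'rV[F]_3}) :
    \dim L = 2 -> row3 0 1 0 \notin L ->
  exists m c, forall x, row3 x (m * x + c) 1 \in L.
Proof.
move=> dL yL; set y := row3 0 1 0 in yL.
have full : (L + <[y]> = fullv)%VS.
  apply/eqP; rewrite eqEdim subvf dimvf /=.
  have -> : dim 'rV[F]_3 = (\dim L).+1 by rewrite dL; exact: dim_matrix.
  rewrite ltn_neqAle dimvS ?addvSl // andbT.
  rewrite (dimv_leqif_eq (addvSl _ _)); apply: contra yL => /eqP ->.
  by rewrite memvE addvSr.
have sec v : exists k, v - k *: y \in L.
  have : v \in (L + <[y]>)%VS by rewrite full memvf.
  by case/memv_addP => u uL [_ /vlineP[k ->] ->]; exists k; rewrite addrK.
have [m mL] := sec (row3 1 0 0); have [c cL] := sec (row3 0 0 1).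
exists (- m), (- c) => x.
rewrite [row3 _ _ _](_ : _ = x *: (row3 1 0 0 - m *: y) + (row3 0 0 1 - c *: y)).
  by rewrite memvD ?memvZ.
apply/rowP => j; rewrite !mxE.
by case: j => [[|[|[|//]]] ?] /=; ring.
Qed.

(** By homogeneity, vanishing at [v] passes to all its multiples, hence to the projective point it
    spans. *)
Lemma graph_form_point (F : fieldType) (d : nat) (b : F) (v : 'rV[F]_3) (L : proj_line F) :
    (0 < d)%N -> v != 0 -> v \in val L -> (graph_form d b).@[v 0] = 0 ->
  exists2 P : proj_point F, rational_point (graph_form d b) P & incident P L.
Proof.
move=> d_gt0 v0 vL fv.
have dv : (\dim <[v]> == 1)%N by rewrite dim_vline v0.
exists (exist _ <[v]>%VS dv); last by rewrite /incident /= -memvE.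
move=> w /vlineP[k ->]; move: fv; rewrite !meval_graph_form !mxE => fv.
case: d d_gt0 fv => // e _ /= fv.
by rewrite -[RHS](mulr0 (k ^+ e.+1)) -[X in _ = _ * X]fv !exprMn exprS; ring.
Qed.

Theorem theorem1p4 (R : realType) (d : nat) (hd : (3 <= d)%N) :
  exists2 c : R, 0 < c &
    forall (p k : nat) (F : finFieldType), prime p -> (0 < k)%N ->
      #|F| = (p ^ k)%N ->
    forall l : nat, c * ln (p ^ k)%N%:R <= l%:R ->
    exists C : 'I_l -> {mpoly F[3]}, blocking_family (fun _ : 'I_l => d) C.
Proof.
exists (2 * d).+1%:R => [|p k F _ _ <- l le_l]; first by rewrite ltr0n.
have d_gt0 : (0 < d)%N by apply: leq_trans hd.
have d_gt1 : (1 < d)%N by apply: leq_trans hd.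
(* [g (m, c)] takes the value [b] at [x] exactly when (x : m x + c : 1) lies on the curve of [b]. *)
pose g (mc : F * F) : {poly F} := - 'X^d + (mc.1 *: 'X + mc.2%:P).
pose hit mc b := [exists x, (g mc).[x] == b].
have size_g mc : size (g mc) = d.+1.
  rewrite size_polyDl size_polyN size_polyXn // ltnS.
  rewrite (leq_trans (size_polyD _ _)) // geq_max.
  rewrite (leq_trans (size_scale_leq _ _)) ?size_polyX //.
  exact: leq_trans (size_polyC_leq1 _) d_gt0.
have F_gt1 : (1 < #|F|)%N := finNzRing_gt1 F.
have hitP mc : (#|F| <= d * #|[set b | hit mc b]|)%N.
  by apply: card_horner_image; rewrite size_g ltnS d_gt0 leqnn.
have [s sP] := greedy_cover l (ltnW F_gt1) hitP.
have covered mc : exists i, hit mc (tnth s i).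
  suff /hasP[b /tnthP[i ->] ?] : has (hit mc) s by exists i.
  (* A single unhit pair would make the greedy count at least 1, contradicting the estimate. *)
  apply: contraTT (expR_ratio_bound d_gt0 F_gt1 le_l) => mcN.
  rewrite -leqNgt -card_prod (leq_trans _ sP) // leq_pmull // card_gt0.
  by apply/set0Pn; exists mc; rewrite inE.
exists (fun i => graph_form d (tnth s i)); split.
- move=> i; split=> //; split; last exact: graph_form_homog.
  by have [] := irreducible_graph_form (tnth s i) d_gt0.
- move=> i; rewrite /geometrically_irreducible map_graph_form.
  exact: irreducible_graph_form.
move=> L; suff [i [v [v0 vL fv]]] :
    exists i v, [/\ v != 0, v \in val L & (graph_form d (tnth s i)).@[v 0] = 0].
  by have [P] := graph_form_point d_gt0 v0 vL fv; exists P; first by exists i.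
have neq0 (v : 'rV[F]_3) j : v 0 j = 1 -> v != 0.
  by move=> vj; apply: contra_eq_neq vj => ->; rewrite mxE eq_sym oner_neq0.
have [yL|yL] := boolP (row3 0 1 0 \in val L).
  (* Every curve contains (0 : 1 : 0), so any index will do; [covered] serves only to supply one. *)
  have [i _] := covered (0, 0); exists i, (row3 0 1 0); split=> //.
    by apply: (neq0 _ 1); rewrite mxE.
  (* Writing [d.-1] as a successor, possible since d >= 2, makes 0^(d-1) vanish. *)
  rewrite meval_graph_form !mxE /= -(prednK d_gt0) -(prednK (_ : 0 < d.-1)%N) ?ltn_predRL //.
  by rewrite !expr0n /= !mulr0 !subr0.
have [m [c mcL]] := line_affine_param (eqP (valP L)) yL.
have [i /existsP[x /eqP gx]] := covered (m, c).
exists i, (row3 x (m * x + c) 1); split=> //.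
  by apply: (neq0 _ 2%R); rewrite mxE.
rewrite meval_graph_form !mxE /= !expr1n -gx !hornerE /=; ring.
Qed.
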